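(* Let $n\ge 2$. There exists a compact set $E\subset\mathbb{R}^n$ of Hausdorff dimension $n/6$ for which the angle set $\mathcal{A}(E)$ has zero (one-dimensional) Lebesgue measure.
   Context: The angle set of $E\subset\mathbb{R}^n$ is $\mathcal{A}(E)=\{\angle yxz : x,y,z \text{ are distinct points of } E\}\subset[0,\pi]$, where $\angle yxz\in[0,\pi]$ is the angle at $x$ between the vectors $y-x$ and $z-x$. *)

(* Defs.v *)
From HB Require Import structures.
From mathcomp Require Import all_boot all_order all_algebra.
From mathcomp Require Import all_classical all_reals all_analysis.

Set Implicit Arguments.
Unset Strict Implicit.
Unset Printing Implicit Defensive.

Import Order.TTheory GRing.Theory Num.Theory.
Import numFieldNormedType.Exports.

Local Open Scope classical_set_scope.
Local Open Scope ring_scope.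

Definition dotp (R : realType) (n : nat) (u v : 'rV[R]_n) : R :=
  \sum_(i < n) u 0 i * v 0 i.

(* The norm [`|u|] that the library puts on row vectors is the sup norm (it
   induces the usual topology); angles and diameters use the Euclidean norm. *)
Definition enorm (R : realType) (n : nat) (u : 'rV[R]_n) : R :=
  Num.sqrt (dotp u u).

(* The angle at [x] between [y - x] and [z - x]; meaningful when [y != x] and
   [z != x], where the argument of [acos] lies in [-1, 1]. *)
Definition angle (R : realType) (n : nat) (y x z : 'rV[R]_n) : R :=
  acos (dotp (y - x) (z - x) / (enorm (y - x) * enorm (z - x))).

Definition angle_set (R : realType) (n : nat) (E : set 'rV[R]_n) : set R :=
  [set t | exists x y z : 'rV[R]_n,
     [/\ [/\ E x, E y & E z], x <> y, x <> z, y <> z & t = angle y x z]].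

Local Open Scope ereal_scope.

(* The added [0] only matters for the empty set, whose diameter is [0]. *)
Definition diam (R : realType) (n : nat) (A : set 'rV[R]_n) : \bar R :=
  ereal_sup (0 |` [set (enorm (x - y))%:E | x in A & y in A]).

(* Since [0 `^ 0 = 1], this makes the empty set contribute [0] also for
   [s = 0], so that the 0-dimensional Hausdorff measure is the counting
   measure. *)
Definition diam_pow (R : realType) (n : nat) (s : R) (A : set 'rV[R]_n) :
    \bar R :=
  if A == set0 then 0 else diam A `^ s.

Definition hausdorff_premeasure (R : realType) (n : nat) (s delta : R)
    (E : set 'rV[R]_n) : \bar R :=
  ereal_inf [set \sum_(0 <= k <oo) diam_pow s (U k) | U in
    [set U : nat -> set 'rV[R]_n |
       E `<=` \bigcup_k U k /\ forall k, diam (U k) <= delta%:E]].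

Definition hausdorff_measure (R : realType) (n : nat) (s : R)
    (E : set 'rV[R]_n) : \bar R :=
  ereal_sup [set hausdorff_premeasure s delta E |
    delta in [set delta : R | (0 < delta)%R]].

Definition hausdorff_dim (R : realType) (n : nat) (E : set 'rV[R]_n) : \bar R :=
  ereal_inf [set s%:E | s in
    [set s : R | (0 <= s)%R /\ hausdorff_measure s E = 0]].

(* Main.v *)
(** If all points of E lie within r of the grid q^-1 Z^n, then, by the law of
    cosines, up to an error O(r) the angles of well separated triples depend
    only on three squared distances in q^-2 Z, each with O(q^2) values. So they
    are covered by O(q^6) intervals of length O(r), and r = o(q^-6) along a
    sequence of scales q makes the angle set negligible. With r slightly
    smaller than q^-6, covering E by q^n cubes of side r gives dimension at
    most n/6.
    For the lower bound, the binary digits of t in [0, 1) are distributed over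
    the free digits of n coordinates, in blocks separated by zeros; if the
    special scales are very sparse, the inverse of this map is Hölder of every
    exponent s < n/6, so an efficient s-dimensional cover of E would give a
    cover of [0, 1) by intervals of total length less than 1. *)
Require Import Defs.
From mathcomp Require Import all_boot all_order all_algebra.
From mathcomp Require Import all_classical all_reals all_analysis.
From mathcomp Require Import ring lra zify.
Import Order.TTheory GRing.Theory Num.Theory.
Import numFieldNormedType.Exports.

Set Implicit Arguments.
Unset Strict Implicit.
Unset Printing Implicit Defensive.

Local Open Scope classical_set_scope.
Local Open Scope ring_scope.

(** * Sparse positions of the digit blocks *)

(* [P m] is the binary position where block [m] starts. Block [m] carries
   [2 m + 1] free digits, so that [m ^ 2] of them precede it, and the position
   [P (g j)] is followed by a gap of zeros multiplying the position by 6. The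
   gaps occur at the block indices [16 ^ 2 ^ j]: each one is the square of its
   predecessor [gap m], whence a contribution of earlier gaps to [P] which is
   only linear in [m]. *)
Lemma sparse_gap_positions :
  exists (P : nat -> nat) (g : nat -> nat) (c : nat),
    [/\ forall m, (P m + 2 * m + 2 <= P m.+1)%N,
        forall m, (P m <= 6 * m ^ 2 + c * m + c)%N &
        forall j, (j <= g j)%N /\
          (6 * P (g j) + j + (2 * g j + 1) <= P (g j).+1)%N].
Proof.
(* [gap m] is the largest [16 ^ 2 ^ j] not exceeding [m], and 16 when [m < 16]. *)
pose gap m := (16 ^ (2 ^ (trunc_log 2 (trunc_log 16 m))))%N.
have gapE j m : (16 ^ 2 ^ j <= m < 16 ^ 2 ^ j.+1)%N -> gap m = (16 ^ 2 ^ j)%N.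
  move=> /andP[jm mj]; rewrite /gap.
  have m_gt0 : (0 < m)%N by apply: leq_trans jm; rewrite expn_gt0.
  congr (16 ^ (2 ^ _))%N; apply: trunc_log_eq => //; apply/andP; split.
    exact: trunc_log_max.
  rewrite -(@ltn_exp2l 16)//; apply: leq_ltn_trans mj.
  exact: trunc_logP.
have gap_mono m : (gap m <= gap m.+1)%N.
  by rewrite /gap leq_exp2l// leq_exp2l// !leq_trunc_log.
have gap_le m : (gap m <= m + 16)%N.
  rewrite /gap; case: (ltnP m 16) => m16.
    by rewrite (eqP (_ : trunc_log 16 m == 0%N)) ?trunc_log0 ?leq_addl// trunc_log_eq0/=.
  have l_gt0 : (0 < trunc_log 16 m)%N by rewrite trunc_log_gt0.
  apply: leq_trans (leq_addr _ _).
  apply: (leq_trans _ (@trunc_logP 16 m _ _)) => //; last lia.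
  by rewrite leq_exp2l// trunc_logP.
(* The term [m ^ 2 + m] makes room for the free digits and one zero per block. When [gap] jumps from
   [d] to [d ^ 2 = m.+1], the term [5 * gap m ^ 2] raises the leading part to [6 * m.+1 ^ 2], and
   [64 * gap m] absorbs the linear errors. *)
exists (fun m => (m ^ 2 + m + 5 * gap m ^ 2 + 64 * gap m)%N).
(* [g j] is the last index before a jump of [gap]. As [gap m <= m + 16], the constant term of the
   upper bound is [5 * 16 ^ 2 + 64 * 16 = 2304]. *)
exists (fun j => (16 ^ 2 ^ j.+1).-1)%N, 2304%N; split => [m|m|j].
- have := gap_mono m; nia.
- have := gap_le m; nia.
- set m := (_ ^ _).-1.
  have d16 : (16 <= 16 ^ 2 ^ j)%N by rewrite (@leq_pexp2l 16 1)// expn_gt0.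
  have jd : (j < 16 ^ 2 ^ j)%N.
    by apply: ltn_trans (ltn_expl _ (isT : 1 < 2)%N) (ltn_expl _ _).
  have mE : m.+1 = ((16 ^ 2 ^ j) ^ 2)%N.
    by rewrite /m prednK ?expn_gt0// -expnM -expnSr.
  have gm : gap m = (16 ^ 2 ^ j)%N.
    by apply: gapE; rewrite (expnSr 2) expnM -mE leqnn andbT; nia.
  have gm1 : gap m.+1 = m.+1.
    by rewrite (gapE j.+1) mE -expnM -expnSr// leqnn/= !ltn_exp2l.
  rewrite gm1 gm; move: mE d16 jd; clearbody m; clear -m; set d := (16 ^ 2 ^ j)%N.
  clearbody d => mE d16 jd.
  have dm : (16 * d <= m.+1)%N by nia.
  split; nia.
Qed.

(** * Binary expansions with separated blocks *)

(** Block [l] is right-aligned: an integer of [2 * l + 1] bits ends at position [P l.+1], so the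
    zeros that separate it from block [l - 1] come first. *)
Definition block_sum (R : realType) (P a : nat -> nat) (m : nat) : R :=
  \sum_(l < m) (a l)%:R / 2 ^+ P l.+1.

Definition block_lim (R : realType) (P a : nat -> nat) : R :=
  sup (range (block_sum R P a)).

Lemma block_sumS (R : realType) (P a : nat -> nat) (m : nat) :
  block_sum R P a m.+1 = block_sum R P a m + (a m)%:R / 2 ^+ P m.+1.
Proof. by rewrite /block_sum big_ord_recr. Qed.

Lemma ler_block_sum (R : realType) (P a : nat -> nat) (m k : nat) :
  (m <= k)%N -> block_sum R P a m <= block_sum R P a k.
Proof.
move=> /subnKC <-; elim: (k - m)%N => [|i IH]; first by rewrite addn0.
by rewrite addnS block_sumS (le_trans IH)// lerDl divr_ge0// exprn_ge0.
Qed.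

(* The sums [block_sum m + 2 ^- P m / 2] decrease, so that the limit lies in
   nested intervals. *)
Lemma block_sum_upper_step (R : realType) (P a : nat -> nat) (m : nat) :
  (a m < 2 ^ (2 * m + 1))%N -> (P m + 2 * m + 2 <= P m.+1)%N ->
  block_sum R P a m.+1 + 2 ^- P m.+1 / 2 <= block_sum R P a m + 2 ^- P m / 2.
Proof.
move=> am Pm; rewrite block_sumS -addrA lerD2l.
have am' : (a m)%:R + 1 <= 2 ^+ (2 * m + 1) :> R.
  by rewrite natr1 -natrX ler_nat.
have P0 : 0 < 2 ^- P m.+1 :> R by rewrite invr_gt0 exprn_gt0.
have : 2 ^+ (2 * m + 1) * 2 ^- P m.+1 <= 2 ^- P m / 2 :> R.
  rewrite -[leRHS]invfM -exprSr ler_pdivrMr ?exprn_gt0// mulrC ler_pdivlMr ?exprn_gt0//.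
  by rewrite -exprD ler_eXn2l ?ltr1n//; lia.
nra.
Qed.

Lemma block_sum_upper (R : realType) (P a : nat -> nat) (m k : nat) :
  (forall l, a l < 2 ^ (2 * l + 1))%N -> (forall l, P l + 2 * l + 2 <= P l.+1)%N ->
  (m <= k)%N ->
  block_sum R P a k + 2 ^- P k / 2 <= block_sum R P a m + 2 ^- P m / 2.
Proof.
move=> aP PP /subnKC <-; elim: (k - m)%N => [|i IH]; first by rewrite addn0.
by rewrite addnS; apply: le_trans IH; exact: block_sum_upper_step.
Qed.

Lemma block_lim_bounds (R : realType) (P a : nat -> nat) (m : nat) :
  (forall l, a l < 2 ^ (2 * l + 1))%N -> (forall l, P l + 2 * l + 2 <= P l.+1)%N ->
  block_sum R P a m <= block_lim R P a <= block_sum R P a m + 2 ^- P m / 2.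
Proof.
move=> aP PP.
have ub : ubound (range (block_sum R P a)) (block_sum R P a m + 2 ^- P m / 2).
  move=> _ [k _ <-]; have [mk|km] := leqP m k.
    apply: le_trans (block_sum_upper R aP PP mk).
    by rewrite lerDl divr_ge0// invr_ge0 exprn_ge0.
  apply: le_trans (ler_block_sum R P a (ltnW km)) _.
  by rewrite lerDl divr_ge0// invr_ge0 exprn_ge0.
apply/andP; split; last by apply: ge_sup => //; exists (block_sum R P a 0), 0%N.
apply: sup_upper_bound; last by exists m.
split; first by exists (block_sum R P a 0), 0%N.
by exists (block_sum R P a m + 2 ^- P m / 2).
Qed.

(** At the first differing block the partial sums differ by at least one unit [2 ^- P m.+1]; the
    zero opening the next block keeps the tails below half a unit. *)
Lemma block_lim_sep (R : realType) (P a b : nat -> nat) (m : nat) :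
  (forall l, a l < 2 ^ (2 * l + 1))%N -> (forall l, b l < 2 ^ (2 * l + 1))%N ->
  (forall l, P l + 2 * l + 2 <= P l.+1)%N ->
  (forall l, (l < m)%N -> a l = b l) -> a m != b m ->
  2 ^- P m.+1 / 2 <= `|block_lim R P a - block_lim R P b|.
Proof.
move=> + + PP; wlog : a b / (b m < a m)%N => [wl aP bP ab|].
  rewrite neq_ltn => /orP[l|l]; last by apply: wl => //; rewrite gtn_eqF.
  by rewrite distrC; apply: wl => //; [move=> k /ab|rewrite gtn_eqF].
move=> ba aP bP ab _; apply: le_trans (ler_norm _).
have /andP[la _] := block_lim_bounds R m.+1 aP PP.
have /andP[_ ub] := block_lim_bounds R m.+1 bP PP.
have E : block_sum R P a m = block_sum R P b m.
  by apply: eq_bigr => l _; rewrite ab.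
move: la ub; rewrite !block_sumS E => la ub.
have P0 : 0 < 2 ^- P m.+1 :> R by rewrite invr_gt0 exprn_gt0.
have : (b m)%:R + 1 <= (a m)%:R :> R by rewrite natr1 ler_nat.
nra.
Qed.

Lemma block_sum_grid (R : realType) (P a : nat -> nat) (m : nat) :
  (forall l, a l < 2 ^ (2 * l + 1))%N -> (forall l, P l + 2 * l + 2 <= P l.+1)%N ->
  exists2 k, (k <= 2 ^ P m)%N & block_sum R P a m = k%:R / 2 ^+ P m.
Proof.
move=> aP PP.
have [k kE] : exists k, block_sum R P a m = k%:R / 2 ^+ P m.
  elim: m => [|m [k kE]]; first by exists 0%N; rewrite /block_sum big_ord0 mul0r.
  exists (k * 2 ^ (P m.+1 - P m) + a m)%N.
  have Pm : (P m <= P m.+1)%N by have := PP m; lia.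
  rewrite block_sumS kE natrD mulrDl natrM natrX; congr (_ + _).
  by rewrite -{2}(subnKC Pm) exprD -mulf_div divff ?mulr1 ?expf_neq0.
exists k => //.
have := block_sum_upper R aP PP (leq0n m).
rewrite kE /block_sum big_ord0 add0r => h.
have P0 : 0 < 2 ^- P m :> R by rewrite invr_gt0 exprn_gt0.
have P1 : 2 ^- P 0%N <= 1 :> R.
  by rewrite invf_le1 ?exprn_gt0// exprn_ege1// ler1n.
have : k%:R / 2 ^+ P m <= 1 :> R by lra.
by rewrite ler_pdivrMr ?exprn_gt0// mul1r -natrX ler_nat.
Qed.

(** The grid point is [block_sum R P a m]. The bits of block [m] all lie beyond position [s], so
    this block and the tail together add at most [2 ^- s]. *)
Lemma block_lim_near_grid (R : realType) (P a : nat -> nat) (m s : nat) :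
  (forall l, a l < 2 ^ (2 * l + 1))%N -> (forall l, P l + 2 * l + 2 <= P l.+1)%N ->
  (s + (2 * m + 1) <= P m.+1)%N ->
  exists2 k, (k <= 2 ^ P m)%N &
    k%:R / 2 ^+ P m <= block_lim R P a <= k%:R / 2 ^+ P m + 2 ^- s.
Proof.
move=> aP PP sP; have [k k2 kE] := block_sum_grid R m aP PP; exists k => //.
rewrite -kE; have /andP[-> _] /= := block_lim_bounds R m aP PP.
have /andP[_ /le_trans] := block_lim_bounds R m.+1 aP PP; apply.
rewrite block_sumS -addrA lerD2l.
have am' : (a m)%:R + 1 <= 2 ^+ (2 * m + 1) :> R.
  by rewrite natr1 -natrX ler_nat.
have P0 : 0 < 2 ^- P m.+1 :> R by rewrite invr_gt0 exprn_gt0.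
have : 2 ^+ (2 * m + 1) * 2 ^- P m.+1 <= 2 ^- s :> R.
  rewrite ler_pdivrMr ?exprn_gt0// mulrC ler_pdivlMr ?exprn_gt0//.
  rewrite -exprD ler_eXn2l ?ltr1n//; lia.
nra.
Qed.

(** * Digits of integers and of reals *)

Lemma eq_of_base_digits (b n x y : nat) :
  (x < b ^ n)%N -> (y < b ^ n)%N ->
  (forall i, (i < n)%N -> (x %/ b ^ i) %% b = (y %/ b ^ i) %% b)%N -> x = y.
Proof.
elim: n x y => [|n IH] x y; first by rewrite expn0 !ltnS !leqn0 => /eqP-> /eqP->.
rewrite expnSr => xb yb h.
have b0 : (0 < b)%N by rewrite lt0n; apply/eqP => b0; move: xb; rewrite b0 muln0.
rewrite (divn_eq x b) (divn_eq y b); congr (_ * _ + _)%N; last first.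
  by have := h 0%N (ltn0Sn _); rewrite expn0 !divn1.
apply: IH; [by rewrite ltn_divLR|by rewrite ltn_divLR|move=> i ii].
by have := h i.+1 ii; rewrite expnS !divnMA.
Qed.

(** For [t] in [0, 1) this is the integer spelled by the first [e] binary digits of [t]. *)
Definition dyadic_floor (R : realType) (t : R) (e : nat) : nat :=
  Num.truncn (2 ^+ e * t).

Lemma dyadic_floor_div (R : realType) (t : R) (e f : nat) : 0 <= t ->
  (dyadic_floor t (e + f) %/ 2 ^ f = dyadic_floor t e)%N.
Proof.
move=> t0; apply/esym/truncn_def.
have p : (0 < 2 ^ f)%N by rewrite expn_gt0.
have /andP[lo hi] : (dyadic_floor t (e + f))%:R <= 2 ^+ (e + f) * t
    < (dyadic_floor t (e + f)).+1%:R by apply: truncn_itv; rewrite mulr_ge0 ?exprn_ge0.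
set k := dyadic_floor t (e + f) in lo hi *.
have f0 : 0 < 2 ^+ f :> R by rewrite exprn_gt0.
rewrite -(ler_pM2l f0) -(ltr_pM2l f0) mulrA -exprD (addnC f).
apply/andP; split.
  by apply: le_trans lo; rewrite -natrX -natrM ler_nat mulnC leq_divM.
apply: lt_le_trans hi _; rewrite -natrX -natrM ler_nat mulnC.
exact: ltn_ceil.
Qed.

Lemma dist_le_of_dyadic_floor (R : realType) (t u : R) (e : nat) : 0 <= t -> 0 <= u ->
  dyadic_floor t e = dyadic_floor u e -> `|t - u| <= 2 ^- e.
Proof.
move=> t0 u0 E.
have e0 : 0 < 2 ^+ e :> R by rewrite exprn_gt0.
have /andP[] : (dyadic_floor t e)%:R <= 2 ^+ e * t < (dyadic_floor t e).+1%:R.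
  by apply: truncn_itv; rewrite mulr_ge0 ?exprn_ge0.
have /andP[] : (dyadic_floor u e)%:R <= 2 ^+ e * u < (dyadic_floor u e).+1%:R.
  by apply: truncn_itv; rewrite mulr_ge0 ?exprn_ge0.
rewrite E -natr1 -[_ ^- e]mul1r ler_pdivlMr//.
rewrite -[X in _ * X <= _](gtr0_norm e0) -normrM [(t - u) * _]mulrC mulrBr ler_norml.
move: (2 ^+ e * t) (2 ^+ e * u) => x y h1 h2 h3 h4; apply/andP; split; lra.
Qed.

(** * The set, the encoding of [0, 1) into it, and the Hölder inverse *)

(** With [N = 2 ^+ q j], the mesh is [N^-1] and the tolerance is [N ^- 6 * 2 ^- j]. The factor
    [2 ^- j] is what drives the measure of the angle covers to 0. *)
Definition near_grid (R : realType) (q : nat -> nat) : set R :=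
  [set x | forall j, exists2 k, (k <= 2 ^ q j)%N &
    k%:R / 2 ^+ q j <= x <= k%:R / 2 ^+ q j + 2 ^- (6 * q j + j)].

Definition near_grid_vectors (R : realType) (n : nat) (q : nat -> nat) : set 'rV[R]_n :=
  [set x | forall i, near_grid q (x ord0 i)].

(** The digits of [t] at positions [n * m ^ 2] to [n * m.+1 ^ 2] form [n] groups of [2 * m + 1]
    bits; coordinate [i] receives group [i], counted from the least significant end. *)
Definition block_digit (R : realType) (n : nat) (t : R) (i m : nat) : nat :=
  ((dyadic_floor t (n * m.+1 ^ 2) %/ (2 ^ (2 * m + 1)) ^ i) %% 2 ^ (2 * m + 1))%N.

Definition encode (R : realType) (n : nat) (P : nat -> nat) (t : R) : 'rV[R]_n :=
  \row_i block_lim R P (block_digit n t i).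

Lemma block_digit_lt (R : realType) (n : nat) (t : R) (i m : nat) :
  (block_digit n t i m < 2 ^ (2 * m + 1))%N.
Proof. by rewrite ltn_mod expn_gt0. Qed.

Lemma encode_near_grid (R : realType) (n : nat) (P g : nat -> nat) (t : R) :
  (forall m, P m + 2 * m + 2 <= P m.+1)%N ->
  (forall j, 6 * P (g j) + j + (2 * g j + 1) <= P (g j).+1)%N ->
  near_grid_vectors (P \o g) (encode n P t).
Proof.
move=> PP Pg i j; rewrite mxE.
exact: block_lim_near_grid (block_digit_lt n t i) PP (Pg j).
Qed.

(** The [n * (2 * m + 1)] new bits are [n] digits in base [2 ^ (2 * m + 1)], namely the block digits
    of the [n] coordinates. *)
Lemma dyadic_floor_step (R : realType) (n m : nat) (t u : R) : 0 <= t -> 0 <= u ->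
  dyadic_floor t (n * m ^ 2) = dyadic_floor u (n * m ^ 2) ->
  (forall i, (i < n)%N -> block_digit n t i m = block_digit n u i m) ->
  dyadic_floor t (n * m.+1 ^ 2) = dyadic_floor u (n * m.+1 ^ 2).
Proof.
move=> t0 u0 E h.
have expE : (n * m.+1 ^ 2 = n * m ^ 2 + (2 * m + 1) * n)%N by nia.
have b0 : (0 < 2 ^ ((2 * m + 1) * n))%N by rewrite expn_gt0.
set x := dyadic_floor t _; set y := dyadic_floor u _.
rewrite (divn_eq x (2 ^ ((2 * m + 1) * n))) (divn_eq y (2 ^ ((2 * m + 1) * n))).
rewrite /x /y {1 3}expE !dyadic_floor_div// E; congr (_ + _)%N.
apply: (@eq_of_base_digits (2 ^ (2 * m + 1)) n); rewrite -?expnM ?ltn_mod// => i ii.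
rewrite -expnM.
have mod_digit w z : (0 < w)%N ->
    ((z %% 2 ^ (w * n)) %/ 2 ^ (w * i) = z %/ 2 ^ (w * i) %[mod 2 ^ w])%N.
  move=> w0; rewrite [in RHS](divn_eq z (2 ^ (w * n))).
  have -> : (w * n = w * (n - i.+1) + w + w * i)%N by nia.
  by rewrite !expnD [in RHS]mulnA divnMDl ?expn_gt0// mulnA modnMDl.
rewrite !mod_digit ?addn_gt0 ?orbT//.
by have := h i ii; rewrite /block_digit -expnM.
Qed.

(** Take for [m] the first block in which some coordinate differs: earlier agreement fixes the first
    [n * m ^ 2] digits of [t] and [u], while the differing coordinate is separated by
    [block_lim_sep]. *)
Lemma encode_sep (R : realType) (n : nat) (P : nat -> nat) (t u : R) :
  (0 < n)%N -> (forall m, P m + 2 * m + 2 <= P m.+1)%N ->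
  0 <= t < 1 -> 0 <= u < 1 -> t != u ->
  exists m, `|t - u| <= 2 ^- (n * m ^ 2) /\
    exists i, 2 ^- P m.+1 / 2 <= `|encode n P t ord0 i - encode n P u ord0 i|.
Proof.
move=> n0 PP /andP[t0 t1] /andP[u0 u1] tu.
have floor0 (x : R) : 0 <= x -> x < 1 -> dyadic_floor x (n * 0 ^ 2) = 0%N.
  by move=> x0 x1; rewrite muln0 /dyadic_floor expr0 mul1r; apply: truncn_def; rewrite x0.
have floorE m : (forall l, (l < m)%N -> forall i : 'I_n, block_digit n t i l = block_digit n u i l) ->
    dyadic_floor t (n * m ^ 2) = dyadic_floor u (n * m ^ 2).
  elim: m => [_|m IH h]; first by rewrite !floor0.
  apply: dyadic_floor_step => //; first by apply: IH => l lm; apply: h; exact: ltnW.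
  by move=> i ii; have := h m (ltnSn m) (Ordinal ii).
(* Otherwise [t] and [u] would be within [2 ^- (n * m ^ 2) <= 2 ^- m] for every [m]. *)
have : exists m, ~~ [forall i : 'I_n, block_digit n t i m == block_digit n u i m].
  apply: contrapT => /forallNP h.
  have {h}h l (i : 'I_n) : block_digit n t i l = block_digit n u i l.
    by have /negP := h l; rewrite negbK => /forallP/(_ i)/eqP.
  have tu0 : 0 < `|t - u| by rewrite normr_gt0 subr_eq0.
  have : exists m, 2 ^- m < `|t - u|.
    exists (Num.truncn `|t - u|^-1).+1.
    rewrite invf_plt ?posrE ?exprn_gt0//; apply: lt_le_trans (truncnS_gt _) _.
    by rewrite -natrX ler_nat ltnW// ltn_expl.
  case=> m; apply/negP; rewrite -leNgt.
  apply: le_trans (dist_le_of_dyadic_floor t0 u0 (floorE m (fun l _ => h l))) _.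
  rewrite lef_pV2 ?posrE ?exprn_gt0// ler_eXn2l ?ltr1n//; nia.
move=> /ex_minnP[m /forallPn[i im] mmin]; exists m.
have h l : (l < m)%N -> forall i : 'I_n, block_digit n t i l = block_digit n u i l.
  move=> lm i'; apply/eqP; move: i'; apply/forallP; apply: contraT => /mmin.
  by rewrite leqNgt lm.
split; first exact: dist_le_of_dyadic_floor (floorE m h).
exists i; rewrite !mxE; apply: block_lim_sep => //; try exact: block_digit_lt.
by move=> l /h.
Qed.

(* The left-hand side is about [6 s m ^ 2] with [6 s < n]. *)
Lemma quadratic_beats_linear (R : realType) (n c : nat) (s : R) (P : nat -> nat) :
  (forall m, P m <= 6 * m ^ 2 + c * m + c)%N -> 0 <= s -> s < n%:R / 6 ->
  exists C : R, forall m, ((P m.+1)%:R + 1) * s <= C + (n * m ^ 2)%:R.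
Proof.
move=> PP s0 sn.
set d := n%:R - 6 * s; have d0 : 0 < d by rewrite /d; lra.
set B := s * (12 + c%:R).
(* Completing the square gives [B * m <= d * m ^ 2 + B ^+ 2 / (4 * d)]; the other summand is [s]
   times the constant term of the bound on [P m.+1 + 1]. *)
exists (B ^+ 2 / (4 * d) + s * (7 + 2 * c%:R)) => m.
have : (P m.+1)%:R + 1 <= 6 * m%:R ^+ 2 + (12 + c%:R) * m%:R + (7 + 2 * c%:R) :> R.
  rewrite -natrX -!natrM -!natrD -natrM -!natrD natr1 ler_nat; have := PP m.+1; nia.
move=> /(ler_wpM2r s0)/le_trans; apply.
have : 0 <= (2 * d * m%:R - B) ^+ 2 / (4 * d) by rewrite divr_ge0 ?sqr_ge0// ltW// mulr_gt0.
have -> : (2 * d * m%:R - B) ^+ 2 / (4 * d) = d * m%:R ^+ 2 - B * m%:R + B ^+ 2 / (4 * d).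
  by field; rewrite gt_eqF.
rewrite natrM natrX /d /B; nra.
Qed.

(** This compares the two bounds of [encode_sep], so that the inverse of [encode] is Hölder of
    exponent [s]. In base-2 logarithms it is the preceding inequality between exponents. *)
Lemma holder_constant (R : realType) (n c : nat) (s : R) (P : nat -> nat) :
  (forall m, P m <= 6 * m ^ 2 + c * m + c)%N -> 0 <= s -> s < n%:R / 6 ->
  exists2 C : R, 0 < C & forall m D, 2 ^- P m.+1 / 2 <= D ->
    2 ^- (n * m ^ 2) <= C * D `^ s.
Proof.
move=> PP s0 sn; have [C hC] := quadratic_beats_linear PP s0 sn.
exists (2 `^ C); first by rewrite powR_gt0.
move=> m D hD.
have p2 k : 2 ^- k = 2 `^ (- k%:R) :> R by rewrite powRN powR_mulrn.
have E : 2 ^- P m.+1 / 2 = 2 `^ (- ((P m.+1)%:R + 1)) :> R.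
  by rewrite -invfM -exprSr p2 natr1.
apply: (@le_trans _ _ (2 `^ C * (2 ^- P m.+1 / 2) `^ s)); last first.
  rewrite ler_pM2l ?powR_gt0//; apply: ge0_ler_powR => //.
    by rewrite nnegrE divr_ge0// invr_ge0 exprn_ge0.
  by rewrite nnegrE (le_trans _ hD)// divr_ge0// invr_ge0 exprn_ge0.
rewrite E -powRrM -powRD; last by apply/implyP; rewrite pnatr_eq0.
rewrite p2 ler_powR ?ler1n//; have := hC m; lra.
Qed.

(** * Euclidean norm and diameter *)

Lemma dotp_ge0 (R : realType) (n : nat) (u : 'rV[R]_n) : 0 <= dotp u u.
Proof. by apply: sumr_ge0 => i _; rewrite -expr2 sqr_ge0. Qed.

Lemma sqr_enorm (R : realType) (n : nat) (u : 'rV[R]_n) : enorm u ^+ 2 = dotp u u.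
Proof. by rewrite sqr_sqrtr ?dotp_ge0. Qed.

Lemma ler_coord_enorm (R : realType) (n : nat) (u : 'rV[R]_n) (i : 'I_n) :
  `|u ord0 i| <= enorm u.
Proof.
rewrite -(@ler_pXn2r _ 2) ?nnegrE ?sqrtr_ge0// sqr_enorm real_normK ?num_real//.
rewrite /dotp (bigD1 i)//= -expr2 lerDl; apply: sumr_ge0 => j _.
by rewrite -expr2 sqr_ge0.
Qed.

Lemma enorm_le_coord (R : realType) (n : nat) (u : 'rV[R]_n) (r : R) :
  0 <= r -> (forall i, `|u ord0 i| <= r) -> enorm u <= n%:R * r.
Proof.
move=> r0 ur; rewrite -(@ler_pXn2r _ 2) ?nnegrE ?sqrtr_ge0 ?mulr_ge0// sqr_enorm.
apply: (@le_trans _ _ (n%:R * r ^+ 2)).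
  rewrite -[X in X%:R]card_ord mulr_natl -sumr_const; apply: ler_sum => i _.
  by rewrite -expr2 -real_normK ?num_real// ler_pXn2r ?nnegrE.
rewrite exprMn ler_wpM2r ?sqr_ge0// -natrX ler_nat; nia.
Qed.

Lemma diam_ge0 (R : realType) (n : nat) (A : set 'rV[R]_n) : (0 <= diam A)%E.
Proof. by apply: ereal_sup_ubound; left. Qed.

Lemma enorm_le_diam (R : realType) (n : nat) (A : set 'rV[R]_n) (x y : 'rV[R]_n) :
  A x -> A y -> ((enorm (x - y))%:E <= diam A)%E.
Proof. by move=> Ax Ay; apply: ereal_sup_ubound; right; exists x => //; exists y. Qed.

Lemma diam_le (R : realType) (n : nat) (A : set 'rV[R]_n) (r : R) : 0 <= r ->
  (forall x y, A x -> A y -> enorm (x - y) <= r) -> (diam A <= r%:E)%E.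
Proof.
move=> r0 h; apply: ge_ereal_sup => _ [->|[x Ax [y Ay <-]]]; rewrite lee_fin//.
exact: h.
Qed.

Lemma diam_pow_ge0 (R : realType) (n : nat) (s : R) (A : set 'rV[R]_n) :
  (0 <= diam_pow s A)%E.
Proof. by rewrite /diam_pow; case: ifP => // _; exact: poweR_ge0. Qed.

(** * Lower bound for the Hausdorff measure *)

(** A closed interval centred at any point of [S] will do, whence the factor 2. *)
Lemma measurable_cover_of_dist_le (R : realType) (S : set R) (r : R) : 0 <= r ->
  (forall t u, S t -> S u -> `|t - u| <= r) ->
  exists B : set R, [/\ measurable B, S `<=` B & (lebesgue_measure B <= (2 * r)%:E)%E].
Proof.
move=> r0 h; have [->|/set0P[t St]] := eqVneq S set0.
  by exists set0; split => //; rewrite measure0 lee_fin mulr_ge0.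
exists `[t - r, t + r]%classic; split => // [u Su|].
  by rewrite /= in_itv/= -ler_distl distrC; exact: h.
rewrite lebesgue_measure_itv/=; case: ifP => _; last by rewrite lee_fin mulr_ge0.
by rewrite -EFinB lee_fin; lra.
Qed.

(* A cover of [E] pulls back along [h] to a cover of [0, 1) by sets of diameter
   at most [C * D `^ s], to which Lebesgue measure is applied. *)
Lemma hausdorff_measure_neq0 (R : realType) (n : nat) (E : set 'rV[R]_n)
    (h : R -> 'rV[R]_n) (C s : R) : 0 < C ->
  (forall t, 0 <= t < 1 -> E (h t)) ->
  (forall t u, 0 <= t < 1 -> 0 <= u < 1 -> t != u ->
    forall D, enorm (h t - h u) <= D -> `|t - u| <= C * D `^ s) ->
  hausdorff_measure s E != 0%E.
Proof.
move=> C0 Eh hol; apply/eqP => H0.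
(* The intervals will have total length below [2 * C * (4 * C)^-1 = 1 / 2]. The scale 1 only serves
   to make all diameters finite. *)
have : (hausdorff_premeasure s 1 E < (4 * C)^-1%:E)%E.
  apply: (@le_lt_trans _ _ 0%E); last by rewrite lte_fin invr_gt0 mulr_gt0.
  by rewrite -H0; apply: ereal_sup_ubound; exists 1 => //=; exact: ltr01.
move=> /ereal_inf_lt[_ [U [EU Ud] <-] sumU].
pose S k := [set t : R | 0 <= t < 1 /\ U k (h t)].
have /choice[B hB] : forall k, exists B : set R, [/\ measurable B, S k `<=` B &
    (lebesgue_measure B <= (2 * C)%:E * diam_pow s (U k))%E].
  move=> k; rewrite /diam_pow; case: eqP => [Uk|_].
    by exists set0; split => // [t [_]|]; rewrite ?Uk// measure0 mule0.
  have [D DE] : exists D, diam (U k) = D%:E.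
    exists (fine (diam (U k))); rewrite fineK// ge0_fin_numE ?diam_ge0//.
    exact: le_lt_trans (Ud k) (ltry _).
  rewrite DE poweR_EFin -EFinM -mulrA; apply: measurable_cover_of_dist_le.
    by rewrite mulr_ge0 ?powR_ge0// ltW.
  move=> t u [t01 Ut] [u01 Uu]; have [->|tu] := eqVneq t u.
    by rewrite subrr normr0 mulr_ge0 ?powR_ge0// ltW.
  by apply: hol => //; rewrite -lee_fin -DE; exact: enorm_le_diam.
have : (lebesgue_measure `[0%R, 1%R[%classic <= \sum_(0 <= k <oo) lebesgue_measure (B k))%E.
  apply: measure_sigma_subadditive => //; first by move=> k; case: (hB k).
  move=> t /=; rewrite in_itv/= => t01; have [k _ Uk] := EU _ (Eh _ t01).
  by exists k => //; case: (hB k) => _ + _; apply.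
have -> : lebesgue_measure (`[0%R, 1%R[%classic : set R) = 1%E.
  by rewrite lebesgue_measure_itv/= lte_fin ltr01 oppr0 adde0.
apply/negP; rewrite -ltNge.
apply: (@le_lt_trans _ _ (\sum_(0 <= k <oo) (2 * C)%:E * diam_pow s (U k))%E).
  by apply: lee_nneseries => k _ //; case: (hB k).
rewrite nneseriesZl; last by move=> k _; exact: diam_pow_ge0.
apply: (@lt_le_trans _ _ ((2 * C)%:E * (4 * C)^-1%:E)%E).
  by rewrite lte_pmul2l// lte_fin mulr_gt0.
by rewrite -EFinM lee_fin invfM mulrACA divff ?gt_eqF// mulr1; lra.
Qed.

(** * Compactness *)

Lemma near_grid_itv (R : realType) (q : nat -> nat) (x : R) :
  near_grid q x -> 0 <= x <= 2.
Proof.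
move=> /(_ 0%N)[k kq /andP[lo hi]].
have k0 : 0 <= k%:R / 2 ^+ q 0%N :> R by rewrite divr_ge0 ?exprn_ge0.
have k1 : k%:R / 2 ^+ q 0%N <= 1 :> R.
  by rewrite ler_pdivrMr ?exprn_gt0// mul1r -natrX ler_nat.
have p1 : 2 ^- (6 * q 0 + 0) <= 1 :> R.
  by rewrite invf_le1 ?exprn_gt0// exprn_ege1// ler1n.
by apply/andP; split; lra.
Qed.

Lemma compact_near_grid (R : realType) (q : nat -> nat) : compact (@near_grid R q).
Proof.
have near_gridE : @near_grid R q = \bigcap_j \bigcup_(k in [set k | (k <= 2 ^ q j)%N])
    `[k%:R / 2 ^+ q j, k%:R / 2 ^+ q j + 2 ^- (6 * q j + j)]%classic.
  apply/seteqP; split => [x h j _|x h j].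
    by have [k kq hk] := h j; exists k => //; rewrite /= in_itv.
  by have [k kq] := h j I; rewrite /= in_itv/=; exists k.
have closed_ng : closed (@near_grid R q).
  rewrite near_gridE.
  apply: closed_bigI => j _; apply: closed_bigcup => [|k _]; last exact: itv_closed.
  by apply: (@sub_finite_set _ _ `I_(2 ^ q j).+1) => // k /=; rewrite ltnS.
apply: subclosed_compact closed_ng (@segment_compact R 0 2) _ => x /near_grid_itv.
by rewrite /= in_itv.
Qed.

Lemma compact_near_grid_vectors (R : realType) (n : nat) (q : nat -> nat) :
  compact (near_grid_vectors q : set 'rV[R]_n).
Proof. exact: (@rV_compact R n (fun=> @near_grid R q) (fun=> @compact_near_grid R q)). Qed.

(** * Upper bound for the dimension *)

(** The finite family is padded with empty sets, which cost 0 even for [s = 0] by the convention in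
    [diam_pow]. *)
Lemma hausdorff_premeasure_le_fin_cover (R : realType) (n : nat) (s delta r : R)
    (E : set 'rV[R]_n) (I : finType) (U : I -> set 'rV[R]_n) :
  0 <= r -> r <= delta -> 0 <= s -> (forall i, (diam (U i) <= r%:E)%E) ->
  E `<=` \bigcup_i U i ->
  (hausdorff_premeasure s delta E <= (#|I|%:R * r `^ s)%:E)%E.
Proof.
move=> r0 rd s0 Ur EU.
pose V k := if insub k is Some i then U (@enum_val I predT i) else set0.
have Vlt k : (#|I| <= k)%N -> V k = set0 by move=> k_ge; rewrite /V insubN// -leqNgt.
have dV k : (diam (V k) <= r%:E)%E.
  rewrite /V; case: insub => [i|]; first exact: Ur.
  by apply: diam_le => // x y [].
apply: (@le_trans _ _ (\sum_(0 <= k <oo) diam_pow s (V k))%E).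
  apply: ereal_inf_lbound; exists V => //; split => [x /EU[i _ Ui]|k].
    exists (enum_rank i) => //; rewrite /V.
    case: insubP => [j _ ji|]; last by rewrite ltn_ord.
    by rewrite (_ : j = enum_rank i) ?enum_rankK//; exact: val_inj.
  by apply: le_trans (dV k) _; rewrite lee_fin.
rewrite (@nneseries_split _ _ 0 #|I|) => [|k _]; last exact: diam_pow_ge0.
rewrite add0n eseries0 ?adde0 => [|k kI _]; last by rewrite Vlt// /diam_pow eqxx.
apply: (@le_trans _ _ (\sum_(0 <= k < #|I|) (r `^ s)%:E)%E).
  apply: lee_sum => k _; rewrite /diam_pow; case: ifP => _.
    by rewrite lee_fin powR_ge0.
  rewrite -poweR_EFin; apply: gt0_ler_poweR => //; rewrite ?in_itv/= ?andbT ?leey ?diam_ge0 ?lee_fin ?r0//.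
by rewrite big_mkord sumEFin sumr_const card_ord mulr_natl.
Qed.

(** The cover has one cube of side [2 ^- (6 * q j)] at each of the [(2 ^ q j + 1) ^ n] grid points;
    the better tolerance [2 ^- (6 * q j + j)] is given away. *)
Lemma near_grid_vectors_cover (R : realType) (n : nat) (q : nat -> nat) (j : nat) (s delta : R) :
  0 <= s -> n%:R * 2 ^- (6 * q j) <= delta ->
  (hausdorff_premeasure s delta (near_grid_vectors q : set 'rV[R]_n) <=
    (2 ^+ (n * (q j).+1) * (n%:R * 2 ^- (6 * q j)) `^ s)%:E)%E.
Proof.
move=> s0 nd.
pose U (f : {ffun 'I_n -> 'I_(2 ^ q j).+1}) := [set x : 'rV[R]_n | forall i,
  (f i)%:R / 2 ^+ q j <= x ord0 i <= (f i)%:R / 2 ^+ q j + 2 ^- (6 * q j)].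
have r0 : 0 <= n%:R * 2 ^- (6 * q j) :> R by rewrite mulr_ge0// invr_ge0 exprn_ge0.
apply: le_trans (hausdorff_premeasure_le_fin_cover (U := U) r0 nd s0 _ _) _.
- move=> f; apply: diam_le => // x y fx fy; apply: enorm_le_coord => [|i].
    by rewrite invr_ge0 exprn_ge0.
  have /andP[] := fx i; have /andP[] := fy i; rewrite !mxE => h1 h2 h3 h4.
  by rewrite ler_norml; apply/andP; split; lra.
- move=> x Ex.
  have /choice[k kP] : forall i, exists k, (k <= 2 ^ q j)%N /\
      k%:R / 2 ^+ q j <= x ord0 i <= k%:R / 2 ^+ q j + 2 ^- (6 * q j + j).
    by move=> i; have [k ? ?] := Ex i j; exists k.
  exists [ffun i => inord (k i)] => // i; rewrite ffunE inordK ?ltnS; last by case: (kP i).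
  have [_ /andP[-> /le_trans]] := kP i; apply; rewrite lerD2l.
  by rewrite lef_pV2 ?posrE ?exprn_gt0// ler_eXn2l ?ltr1n// leq_addr.
- rewrite lee_fin ler_wpM2r ?powR_ge0// card_ffun !card_ord -natrX ler_nat.
  have [->|n0] := posnP n; first by rewrite mul0n.
  rewrite mulnC expnM leq_exp2r// expnS.
  have := expn_gt0 2 (q j); lia.
Qed.

Lemma exists_expr_lt (R : realType) (z e : R) : 0 <= z < 1 -> 0 < e ->
  exists N, forall k, (N <= k)%N -> z ^+ k < e.
Proof.
move=> /andP[z0 z1] e0.
have /cvgrPdist_lt/(_ e e0)[N _ hN] : z ^+ k @[k --> \oo] --> 0.
  by apply: cvg_expr; rewrite ger0_norm.
exists N => k Nk; have := hN k Nk; rewrite /= sub0r normrN ger0_norm//.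
exact: exprn_ge0.
Qed.

Lemma hausdorff_measure_near_grid_vectors (R : realType) (n : nat) (q : nat -> nat) (s : R) :
  (forall j, j <= q j)%N -> 0 <= s -> n%:R / 6 < s ->
  hausdorff_measure s (near_grid_vectors q : set 'rV[R]_n) = 0%E.
Proof.
move=> jq s0 ns; apply/eqP; rewrite eq_le; apply/andP; split; last first.
  apply: (@le_trans _ _ (hausdorff_premeasure s 1 (near_grid_vectors q : set 'rV[R]_n))).
    apply: le_ereal_inf_tmp => _ [U _ <-]; apply: nneseries_ge0 => k _ _; exact: diam_pow_ge0.
  by apply: ereal_sup_ubound; exists 1 => //=; exact: ltr01.
apply: ge_ereal_sup => _ [delta /= delta0 <-]; apply/lee_addgt0Pr => e e0; rewrite add0e.
(* The cover at scale [q j] costs at most [K * z ^+ q j], and [z < 1] because [n < 6 * s]. *)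
pose z : R := 2 `^ (n%:R - 6 * s).
have z1 : 0 <= z < 1.
  rewrite powR_ge0/= /z /powR gt_eqF// expR_lt1 nmulr_rlt0 ?ln_gt0 ?ltr1n//; lra.
pose K : R := 2 ^+ n * n%:R `^ s.
have K0 : 0 <= K by rewrite mulr_ge0 ?exprn_ge0 ?powR_ge0.
have [N1 hN1] := exists_expr_lt z1 (divr_gt0 e0 (ltr_pwDr ltr01 K0)).
have h1 : 0 <= (2^-1 : R) < 1 by apply/andP; split; lra.
have [N2 hN2] := exists_expr_lt h1 (divr_gt0 delta0 (ltr_pwDr ltr01 (ler0n R n))).
pose j := (N1 + N2)%N.
have := hN1 (q j) (leq_trans (leq_addr _ _) (jq j)).
have := hN2 (q j) (leq_trans (leq_addl _ _) (jq j)).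
rewrite !ltr_pdivlMr ?ltr_wpDl// exprVn => q1 q2.
apply: le_trans (near_grid_vectors_cover (j := j) s0 _) _.
  have : 2 ^- (6 * q j) <= 2 ^- q j :> R.
    by rewrite lef_pV2 ?posrE ?exprn_gt0// ler_eXn2l ?ltr1n// leq_pmull.
  have : 0 <= 2 ^- q j :> R by rewrite invr_ge0 exprn_ge0.
  have := ler0n R n; nra.
rewrite lee_fin mulnS exprD powRM ?invr_ge0 ?exprn_ge0// mulrACA -/K mulrC.
have -> : 2 ^+ (n * q j) * (2 ^- (6 * q j)) `^ s = z ^+ q j.
  rewrite -!powR_mulrn ?powR_ge0// -powRN -!powRrM -powRD.
    by congr (_ `^ _); rewrite !natrM; ring.
  by apply/implyP; rewrite pnatr_eq0.
have : 0 <= z ^+ q j by rewrite exprn_ge0//; case/andP: z1.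
nra.
Qed.

(** * Angles as stable functions of squared distances *)

Lemma law_of_cosines (R : realType) (n : nat) (x y z : 'rV[R]_n) :
  2 * dotp (y - x) (z - x) =
  dotp (y - x) (y - x) + dotp (z - x) (z - x) - dotp (y - z) (y - z).
Proof.
rewrite /dotp mulr_sumr -big_split/= -sumrB; apply: eq_bigr => i _.
by rewrite !mxE; ring.
Qed.

Lemma cauchy_schwarz (R : realType) (n : nat) (u v : 'rV[R]_n) :
  `|dotp u v| <= enorm u * enorm v.
Proof.
have [v0|v0] := eqVneq (dotp v v) 0.
  have vi i : v 0 i = 0.
    by have := ler_coord_enorm v i; rewrite /enorm v0 sqrtr0 normr_le0 => /eqP.
  rewrite (_ : dotp u v = 0) ?normr0 ?mulr_ge0 ?sqrtr_ge0//.
  by rewrite /dotp big1// => i _; rewrite vi mulr0.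
have vv : 0 < dotp v v by rewrite lt_def v0 dotp_ge0.
rewrite -(@ler_pXn2r _ 2) ?nnegrE ?mulr_ge0 ?sqrtr_ge0// exprMn !sqr_enorm.
rewrite real_normK ?num_real//.
have expand a b : dotp (a *: u - b *: v) (a *: u - b *: v) =
    a ^+ 2 * dotp u u - 2 * (a * b) * dotp u v + b ^+ 2 * dotp v v.
  rewrite /dotp !mulr_sumr -sumrB -big_split/=.
  by apply: eq_bigr => i _; rewrite !mxE; ring.
(* Up to the factor [dotp v v], this vector is the component of [u] orthogonal to [v]. *)
have := dotp_ge0 (dotp v v *: u - dotp u v *: v); rewrite expand.
set w := (X in 0 <= X); have -> : w = dotp v v * (dotp u u * dotp v v - dotp u v ^+ 2).
  by rewrite /w; ring.
by rewrite pmulr_rge0// subr_ge0.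
Qed.

(** Between grid points the squared distance is a sum of [n] integer squares over [4 ^+ q j]; this
    integer is the [b] chosen. *)
Lemma sqdist_near_grid (R : realType) (n : nat) (q : nat -> nat) (j : nat) (x y : 'rV[R]_n) :
  near_grid_vectors q x -> near_grid_vectors q y ->
  exists2 b, (b <= n * 4 ^ q j)%N &
    `|dotp (x - y) (x - y) - b%:R / 4 ^+ q j| <= 3 * n%:R * 2 ^- (6 * q j + j).
Proof.
move=> Ex Ey; set r := 2 ^- (6 * q j + j).
have gridP (v : 'rV[R]_n) : near_grid_vectors q v -> exists k : 'I_n -> nat,
    forall i, (k i <= 2 ^ q j)%N /\ (k i)%:R / 2 ^+ q j <= v ord0 i <= (k i)%:R / 2 ^+ q j + r.
  move=> Ev; have /choice[k kP] : forall i, exists k, (k <= 2 ^ q j)%N /\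
      k%:R / 2 ^+ q j <= v ord0 i <= k%:R / 2 ^+ q j + r.
    by move=> i; have [k ? ?] := Ev i j; exists k.
  by exists k.
have [k kP] := gridP _ Ex; have [l lP] := gridP _ Ey.
exists (\sum_(i < n) (`|(k i)%:Z - (l i)%:Z| ^ 2))%N.
  rewrite -[X in (_ <= X * _)%N]card_ord -sum_nat_const; apply: leq_sum => i _.
  rewrite (_ : 4 = 2 ^ 2)%N// -expnM mulnC expnM leq_exp2r//.
  have [ki _] := kP i; have [li _] := lP i; lia.
have -> : 3 * n%:R * r = \sum_(i < n) (3 * r).
  by rewrite sumr_const card_ord -mulr_natl; ring.
rewrite natr_sum mulr_suml -sumrB.
apply: le_trans (ler_norm_sum _ _ _) _; apply: ler_sum => i _.
have [ki /andP[k1 k2]] := kP i; have [li /andP[l1 l2]] := lP i.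
have r0 : 0 <= r by rewrite invr_ge0 exprn_ge0.
have r1 : r <= 1 by rewrite invf_le1 ?exprn_gt0// exprn_ege1// ler1n.
have -> : ((`|(k i)%:Z - (l i)%:Z| ^ 2)%N)%:R / 4 ^+ q j
    = ((k i)%:R / 2 ^+ q j - (l i)%:R / 2 ^+ q j) ^+ 2 :> R.
  rewrite -mulrBl exprMn exprVn -exprM mulnC exprM (_ : 2 ^+ 2 = 4 :> R); last by ring.
  by rewrite natrX natr_absz intr_norm real_normK ?num_real// rmorphB.
have unit k' : (k' <= 2 ^ q j)%N -> 0 <= (k'%:R : R) / 2 ^+ q j <= 1.
  move=> kq; rewrite divr_ge0 ?exprn_ge0//=.
  by rewrite ler_pdivrMr ?exprn_gt0// mul1r -natrX ler_nat.
rewrite !mxE; move: k1 k2 l1 l2 (unit _ ki) (unit _ li).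
move: (_ / _) ((l i)%:R / _) (x ord0 i) (y ord0 i) => a b xi yi.
move=> k1 k2 l1 l2 /andP[a0 a1] /andP[b0 b1].
(* Here [a - b] is at most 1 in absolute value and the perturbation at most [r <= 1], so the first
   factor is at most 3. *)
have -> : (xi - yi) * (xi - yi) - (a - b) ^+ 2 =
    (2 * (a - b) + (xi - yi - (a - b))) * (xi - yi - (a - b)) by ring.
by rewrite normrM; apply: ler_pM => //; rewrite ler_norml; apply/andP; split; lra.
Qed.

(** By the mean value theorem, [K] can be the inverse of the minimum of [sin] on [[eta, pi - eta]],
    which is positive. If that interval is empty, any [K] works. *)
Lemma dist_le_cos_dist (R : realType) (eta : R) : 0 < eta ->
  exists2 K : R, 0 < K & forall t u, eta <= t <= pi - eta -> eta <= u <= pi - eta ->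
    `|t - u| <= K * `|cos t - cos u|.
Proof.
move=> eta0; have [le_eta|lt_eta] := leP eta (pi - eta); last first.
  by exists 1 => // t u /andP[h1 h2]; have := le_lt_trans (le_trans h1 h2) lt_eta; rewrite ltxx.
have [c] := @EVT_min R sin eta (pi - eta) le_eta (continuous_subspaceT (@continuous_sin R)).
rewrite in_itv/= => /andP[c1 c2] cmin.
have sc : 0 < sin c by apply: sin_gt0_pi; apply/andP; split; lra.
exists (sin c)^-1; first by rewrite invr_gt0.
move=> t u; wlog tu : t u / t <= u => [wl|] ht hu.
  have [tu|/ltW ut] := leP t u; first exact: wl.
  by rewrite distrC [X in _ * X]distrC; exact: wl.
rewrite mulrC ler_pdivlMr//.
have [x] := @MVT_segment R cos (fun y => - sin y) t u tu
  (fun y _ => is_derive_cos y) (continuous_subspaceT (@continuous_cos R)).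
rewrite in_itv/= => /andP[x1 x2] E.
rewrite [X in _ <= X]distrC E normrM normrN (distrC t) mulrC ler_wpM2r//.
apply: le_trans (ler_norm _); apply: cmin; rewrite in_itv/=.
by case/andP: ht => ? ?; case/andP: hu => ? ?; apply/andP; split; lra.
Qed.

Lemma dist_le_of_dist_sqr (R : realType) (eta r B B' : R) : 0 < eta ->
  eta <= B -> eta <= B' -> `|B ^+ 2 - B' ^+ 2| <= r -> `|B - B'| <= r / (2 * eta).
Proof.
move=> eta0 B1 B2; rewrite subr_sqr normrM ler_pdivlMr ?mulr_gt0// => /(le_trans _); apply.
by rewrite ler_wpM2l// ger0_norm; lra.
Qed.

Lemma cos_quotient_dist (R : realType) (eta M r a B G a' B' G' : R) :
  0 < eta -> eta <= B -> eta <= G -> eta <= B' -> eta <= G' -> G' <= M ->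
  `|a'| <= B' * G' -> `|a - a'| <= r ->
  `|B ^+ 2 - B' ^+ 2| <= r -> `|G ^+ 2 - G' ^+ 2| <= r ->
  `|a / (B * G) - a' / (B' * G')| <= (eta ^- 2 + M / (2 * eta) / eta ^+ 2 + eta^-1 / (2 * eta)) * r.
Proof.
move=> eta0 hB hG hB' hG' hM ha' haa /(dist_le_of_dist_sqr eta0 hB hB') dB.
move=> /(dist_le_of_dist_sqr eta0 hG hG') dG.
have B0 : 0 < B by lra. have G0 : 0 < G by lra.
have B'0 : 0 < B' by lra. have G'0 : 0 < G' by lra.
have r0 : 0 <= r by apply: le_trans haa.
set e := r / (2 * eta) in dB dG; have e0 : 0 <= e by rewrite divr_ge0// mulr_ge0// ltW.
(* The numerator is changed first, then [B], then [G]; the factor [a' / (B' * G')] is at most 1 in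
   absolute value by the Cauchy-Schwarz type hypothesis. *)
have -> : a / (B * G) - a' / (B' * G') =
    (a - a') / (B * G) + a' / (B' * G') * ((B' - B) * G' / (B * G) + (G' - G) / G).
  by field; rewrite !gt_eqF.
have -> : (eta ^- 2 + M / (2 * eta) / eta ^+ 2 + eta^-1 / (2 * eta)) * r =
    r / eta ^+ 2 + 1 * (e * M / eta ^+ 2 + e / eta).
  by rewrite /e; field; rewrite gt_eqF.
have BG : eta ^+ 2 <= B * G by rewrite expr2 ler_pM// ltW.
have eta2 : 0 < eta ^+ 2 by rewrite exprn_gt0.
have BG0 : 0 < B * G by rewrite mulr_gt0.
have BG'0 : 0 < B' * G' by rewrite mulr_gt0.
have frac (x y z w : R) : 0 <= x -> x <= y -> 0 < w -> w <= z -> x / z <= y / w.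
  move=> x0 xy w0 wz; have z0 := lt_le_trans w0 wz.
  have zw : z^-1 <= w^-1 by rewrite lef_pV2 ?posrE.
  by apply: ler_pM => //; rewrite invr_ge0 ltW.
apply: le_trans (ler_normD _ _) _; apply: lerD.
  by rewrite normrM normfV (gtr0_norm BG0); exact: frac.
rewrite normrM; apply: ler_pM => //.
  by rewrite normrM normfV (gtr0_norm BG'0) ler_pdivrMr// mul1r.
apply: le_trans (ler_normD _ _) _; apply: lerD.
  rewrite !normrM normfV (gtr0_norm BG0) (gtr0_norm G'0); apply: frac => //.
    by rewrite mulr_ge0// ltW.
  by apply: ler_pM => //; [exact: ltW|rewrite distrC].
by rewrite normrM normfV (gtr0_norm G0); apply: frac => //; rewrite distrC.
Qed.

(** * Null sets from small covers *)

Lemma negligible_of_small_covers (R : realType) (A : set R) :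
  (forall e : R, 0 < e -> exists B : set R,
    [/\ measurable B, A `<=` B & (lebesgue_measure B <= e%:E)%E]) ->
  (@lebesgue_measure R).-negligible A.
Proof.
move=> h.
have /choice[B hB] : forall k : nat, exists B : set R,
    [/\ measurable B, A `<=` B & (lebesgue_measure B <= (k.+1%:R^-1)%:E)%E].
  by move=> k; apply: h; rewrite invr_gt0.
have mB : measurable (\bigcap_k B k) by apply: bigcapT_measurable => k; case: (hB k).
exists (\bigcap_k B k); split => //; last by move=> x Ax k _; case: (hB k) => _ + _; apply.
apply/eqP; rewrite eq_le measure_ge0 andbT; apply/lee_addgt0Pr => e e0; rewrite add0e.
pose k := Num.truncn e^-1.
apply: (@le_trans _ _ (lebesgue_measure (B k))).
  apply: le_measure; rewrite ?inE//; first by case: (hB k).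
  exact: bigcap_inf.
case: (hB k) => _ _ /le_trans; apply; rewrite lee_fin.
by rewrite invf_ple ?posrE// ltW// truncnS_gt.
Qed.

Lemma measurable_fin_cover (R : realType) (I : finType) (S : I -> set R) (r : R) : 0 <= r ->
  (forall i t u, S i t -> S i u -> `|t - u| <= r) ->
  exists B : set R, [/\ measurable B, \bigcup_i S i `<=` B &
    (lebesgue_measure B <= (#|I|%:R * (2 * r))%:E)%E].
Proof.
move=> r0 Sr.
suff : forall s : seq I, exists B : set R, [/\ measurable B,
    forall i, i \in s -> S i `<=` B & (lebesgue_measure B <= ((size s)%:R * (2 * r))%:E)%E].
  move=> /(_ (enum I))[B [mB SB]]; rewrite -cardE => lB; exists B; split => // t [i _].
  by apply: SB; rewrite mem_enum.
elim=> [|i s [B [mB SB lB]]].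
  by exists set0; split => //; rewrite measure0 mul0r.
have [B' [mB' SB' lB']] := measurable_cover_of_dist_le r0 (Sr i).
exists (B' `|` B); split; first exact: measurableU.
  move=> k; rewrite inE => /orP[/eqP ->|ks]; first by move=> t /SB'; left.
  by move=> t /(SB _ ks); right.
apply: (@le_trans _ _ (lebesgue_measure B' + lebesgue_measure B)%E).
  exact: measureU2.
by rewrite /= -natr1 mulrDl mul1r EFinD addeC; exact: leeD.
Qed.

(** * The angle set is negligible *)

(** The sides stay away from 0, where the quotient is unstable, and [t] from 0 and pi, where the
    inverse of [cos] is not Lipschitz. *)
Definition separated_angles (R : realType) (n : nat) (E : set 'rV[R]_n) (eta : R) : set R :=
  [set t | eta <= t <= pi - eta /\ exists x y z : 'rV[R]_n,
     [/\ [/\ E x, E y & E z], eta <= enorm (y - x), eta <= enorm (z - x) &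
         cos t = dotp (y - x) (z - x) / (enorm (y - x) * enorm (z - x))]].

Lemma enorm_near_grid_sub (R : realType) (n : nat) (q : nat -> nat) (x y : 'rV[R]_n) :
  near_grid_vectors q x -> near_grid_vectors q y -> enorm (x - y) <= n%:R * 2.
Proof.
move=> Ex Ey; apply: enorm_le_coord => // i.
have /andP[x0 x2] := near_grid_itv (Ex i); have /andP[y0 y2] := near_grid_itv (Ey i).
by rewrite !mxE ler_norml; apply/andP; split; lra.
Qed.

(** Triples are classified by three rounded squared distances: at most [(n.+1 * 4 ^ q j) ^ 3]
    classes, each with angles in a set of diameter [O(2 ^- (6 * q j + j))]. Since [4 ^ 3 = 2 ^ 6],
    the product is [O(2 ^- j)]. *)
Lemma separated_angles_cover (R : realType) (n : nat) (q : nat -> nat) (eta : R) : 0 < eta ->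
  exists2 C : R, 0 < C & forall j, exists B : set R,
    [/\ measurable B, separated_angles (near_grid_vectors q : set 'rV[R]_n) eta `<=` B &
      (lebesgue_measure B <= (C * 2 ^- j)%:E)%E].
Proof.
move=> eta0; have [K K0 hK] := dist_le_cos_dist eta0.
pose L := eta ^- 2 + n%:R * 2 / (2 * eta) / eta ^+ 2 + eta^-1 / (2 * eta).
have L0 : 0 < L.
  have ie0 := ltW eta0.
  rewrite /L -addrA ltr_wpDr ?invr_gt0 ?exprn_gt0// addr_ge0//.
    by rewrite !divr_ge0 ?mulr_ge0 ?exprn_ge0.
  by rewrite divr_ge0 ?mulr_ge0 ?invr_ge0.
(* Within a class each squared distance varies by at most [2 * 3 * n.+1 * r], so the inner product,
   half a signed sum of three of them, varies by at most [9 * n.+1 * r]. Using [n.+1] absorbs the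
   extra 1 in [N]. *)
exists (n.+1%:R ^+ 3 * (2 * (K * (L * (9 * n.+1%:R))))).
  by rewrite !mulr_gt0 ?exprn_gt0.
move=> j; set r : R := 2 ^- (6 * q j + j).
have r0 : 0 < r by rewrite invr_gt0 exprn_gt0.
pose N := (n * 4 ^ q j).+1.
pose near (b : 'I_N) (x y : 'rV[R]_n) :=
  `|dotp (x - y) (x - y) - b%:R / 4 ^+ q j| <= 3 * n.+1%:R * r.
pose S (b : 'I_N * 'I_N * 'I_N) := [set t | eta <= t <= pi - eta /\ exists x y z : 'rV[R]_n,
  [/\ [/\ near_grid_vectors q x, near_grid_vectors q y & near_grid_vectors q z],
    [/\ near b.1.1 y x, near b.1.2 z x & near b.2 y z],
    eta <= enorm (y - x), eta <= enorm (z - x) &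
    cos t = dotp (y - x) (z - x) / (enorm (y - x) * enorm (z - x))]].
have rho0 : 0 <= K * (L * (9 * n.+1%:R * r)) by rewrite !mulr_ge0// ltW.
have Sdist b t u : S b t -> S b u -> `|t - u| <= K * (L * (9 * n.+1%:R * r)).
  move=> [ht [x [y [z [[Ex Ey Ez] [n1 n2 n3] yx zx ct]]]]].
  move=> [hu [x' [y' [z' [[Ex' Ey' Ez'] [n1' n2' n3'] yx' zx' cu]]]]].
  apply: le_trans (hK _ _ ht hu) _; rewrite ler_pM2l// ct cu.
  have merge (v w c s : R) : `|v - c| <= s -> `|w - c| <= s -> `|v - w| <= 2 * s.
    by rewrite !ler_norml => /andP[? ?] /andP[? ?]; apply/andP; split; lra.
  have m1 := merge _ _ _ _ n1 n1'; have m2 := merge _ _ _ _ n2 n2'.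
  have m3 := merge _ _ _ _ n3 n3'.
  have nr0 : 0 <= n.+1%:R * r by rewrite mulr_ge0// ltW.
  apply: cos_quotient_dist => //.
  - exact: enorm_near_grid_sub Ez' Ex'.
  - exact: cauchy_schwarz.
  - have e1 := law_of_cosines x y z; have e2 := law_of_cosines x' y' z'.
    move: m1 m2 m3; rewrite !ler_norml => /andP[? ?] /andP[? ?] /andP[? ?].
    by apply/andP; split; lra.
  - by rewrite !sqr_enorm; apply: le_trans m1 _; lra.
  - by rewrite !sqr_enorm; apply: le_trans m2 _; lra.
have [B [mB SB lB]] := measurable_fin_cover rho0 Sdist.
exists B; split => //.
  apply: subset_trans SB => t [ht [x [y [z [[Ex Ey Ez] yx zx ct]]]]].
  have nearP (v w : 'rV[R]_n) : near_grid_vectors q v -> near_grid_vectors q w ->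
      exists b, near b v w.
    move=> Ev Ew; have [b bN hb] := sqdist_near_grid j Ev Ew.
    exists (inord b); rewrite /near inordK ?ltnS//; apply: le_trans hb _.
    by rewrite ler_wpM2r ?(ltW r0)// ler_wpM2l// ler_nat.
  have [b1 h1] := nearP _ _ Ey Ex; have [b2 h2] := nearP _ _ Ez Ex.
  have [b3 h3] := nearP _ _ Ey Ez.
  by exists (b1, b2, b3) => //; split => //; exists x, y, z.
apply: le_trans lB _; rewrite lee_fin !card_prod !card_ord.
have NE : N%:R <= n.+1%:R * 4 ^+ q j :> R.
  by rewrite -natrX -natrM ler_nat /N; have := expn_gt0 4 (q j); nia.
have -> : n.+1%:R ^+ 3 * (2 * (K * (L * (9 * n.+1%:R)))) * 2 ^- j =
    (n.+1%:R * 4 ^+ q j) ^+ 3 * (2 * (K * (L * (9 * n.+1%:R * r)))).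
  have -> : 2 ^- j = (4 ^+ q j) ^+ 3 * r :> R.
    have -> : (4 ^+ q j) ^+ 3 = 2 ^+ (6 * q j) :> R.
      rewrite (_ : 4 = 2 ^+ 2); last by ring.
      by rewrite -!exprM; congr (_ ^+ _); lia.
    by rewrite /r exprD invfM mulrA divff ?mul1r// expf_neq0.
  by ring.
rewrite ler_pM2r ?mulr_gt0//.
by rewrite !natrM -expr2 -exprSr; apply: lerXn2r => //; rewrite nnegrE ?mulr_ge0 ?exprn_ge0.
Qed.

Lemma negligible_separated_angles (R : realType) (n : nat) (q : nat -> nat) (eta : R) :
  0 < eta ->
  (@lebesgue_measure R).-negligible
    (separated_angles (near_grid_vectors q : set 'rV[R]_n) eta).
Proof.
move=> eta0; have [C C0 hC] := separated_angles_cover n q eta0.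
apply: negligible_of_small_covers => e e0.
have h1 : 0 <= (2^-1 : R) < 1 by apply/andP; split; lra.
have [N hN] := exists_expr_lt h1 (divr_gt0 e0 C0).
have [B [mB SB lB]] := hC N; exists B; split => //.
apply: le_trans lB _; rewrite lee_fin mulrC -ler_pdivlMr// -exprVn ltW//.
exact: hN.
Qed.

Lemma angle_set_sub (R : realType) (n : nat) (E : set 'rV[R]_n) :
  angle_set E `<=` ([set 0] `|` [set pi]) `|` \bigcup_m separated_angles E (m.+1%:R^-1).
Proof.
move=> t [x [y [z [[Ex Ey Ez] xy xz yz tE]]]].
have enorm_gt0 (v : 'rV[R]_n) : x <> v -> 0 < enorm (v - x).
  move=> xv; rewrite lt_def sqrtr_ge0 andbT; apply/eqP => v0; apply: xv.
  apply/rowP => i; have := ler_coord_enorm (v - x) i; rewrite v0 normr_le0 !mxE subr_eq0.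
  by move=> /eqP.
have yx0 := enorm_gt0 _ xy; have zx0 := enorm_gt0 _ xz.
have [/andP[t0 tpi] ct] : 0 <= t <= pi /\
    cos t = dotp (y - x) (z - x) / (enorm (y - x) * enorm (z - x)).
  rewrite tE; apply: acos_def; rewrite -ler_norml normrM normfV.
  rewrite (gtr0_norm (mulr_gt0 yx0 zx0)) ler_pdivrMr ?mulr_gt0// mul1r.
  exact: cauchy_schwarz.
have [->|tn0] := eqVneq t 0; first by left; left.
have [->|tnpi] := eqVneq t pi; first by left; right.
right.
have t_gt0 : 0 < t by rewrite lt_def tn0.
have t_ltpi : 0 < pi - t by rewrite subr_gt0 lt_def eq_sym tnpi.
(* An angle other than 0 and pi is separated at any level below these four positive quantities. *)
pose eta := Num.min (Num.min t (pi - t)) (Num.min (enorm (y - x)) (enorm (z - x))).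
have eta0 : 0 < eta by rewrite !lt_min t_gt0 t_ltpi yx0 zx0.
pose m := Num.truncn eta^-1; exists m => //.
have : m.+1%:R^-1 <= eta by rewrite invf_ple ?posrE// ltW// truncnS_gt.
rewrite !le_min => /andP[/andP[m1 m2] /andP[m3 m4]].
split; first by rewrite m1 lerBrDr addrC -lerBrDr.
by exists x, y, z.
Qed.

Lemma negligible_set1 (R : realType) (x : R) : (@lebesgue_measure R).-negligible [set x].
Proof. by apply/negligibleP => //; exact: lebesgue_measure_set1. Qed.

Lemma negligible_angle_set (R : realType) (n : nat) (q : nat -> nat) :
  (@lebesgue_measure R).-negligible (angle_set (near_grid_vectors q : set 'rV[R]_n)).
Proof.
set E := near_grid_vectors q.
suff : (@lebesgue_measure R).-negligible
    (([set 0] `|` [set pi]) `|` \bigcup_m separated_angles E (m.+1%:R^-1)).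
  by apply: negligibleS; exact: angle_set_sub.
apply: negligibleU; first by apply: negligibleU; exact: negligible_set1.
by apply: negligible_bigcup => m; apply: negligible_separated_angles.
Qed.

(** * Assembly of the three properties *)

Theorem theorem3p5 (R : realType) (n : nat) (hn : (2 <= n)%N) :
  exists E : set 'rV[R]_n,
    [/\ compact E,
        hausdorff_dim E = (n%:R / 6)%:E &
        (@lebesgue_measure R).-negligible (angle_set E)].
Proof.
have [P [g [c [PP Pc Pg]]]] := sparse_gap_positions.
have leP : forall m, (m <= P m)%N by elim=> // m IH; have := PP m; lia.
exists (near_grid_vectors (P \o g)); split.
- exact: compact_near_grid_vectors.
- apply/eqP; rewrite eq_le; apply/andP; split.
    apply/lee_addgt0Pr => e e0; apply: ereal_inf_lbound.
    have n6 : 0 <= n%:R / 6 :> R by rewrite divr_ge0.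
    exists (n%:R / 6 + e) => //; split; first by rewrite addr_ge0// ltW.
    apply: hausdorff_measure_near_grid_vectors; rewrite ?ltrDl//.
      by move=> j; apply: leq_trans (leP (g j)); case: (Pg j).
    by rewrite addr_ge0// ltW.
  (* For [s < n / 6] the Hölder inverse of [encode] forces a nonzero [s]-dimensional measure. *)
  apply: le_ereal_inf_tmp => _ [s [s0 Hs] <-]; rewrite lee_fin leNgt; apply/negP => sn.
  have [C C0 hC] := holder_constant Pc s0 sn.
  move/eqP: Hs; apply/negP.
  apply: (hausdorff_measure_neq0 (h := encode n P) C0) => [t _|t u t01 u01 tu D tuD].
    by apply: encode_near_grid => // j; case: (Pg j).
  have [m [tum [i im]]] := encode_sep (ltnW hn) PP t01 u01 tu.
  apply: le_trans tum _; apply: hC; apply: le_trans im _; apply: le_trans tuD.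
  by have := ler_coord_enorm (encode n P t - encode n P u) i; rewrite !mxE.
- exact: negligible_angle_set.
Qed.
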